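(* Let $p,q,s,t$ be nonnegative real numbers and let $(d_n)_{n\ge 0}$ be defined by $$\sum_{n\ge 0}d_nx^n=\frac{2t}{2t-q+(qs-2pt)x+q\sqrt{1-2sx+(s^2-4t)x^2}}.$$ If $s^2\ge 4t$ and $p\,(s+\sqrt{s^2-4t})/2\ge q$, then $(d_n)_{n\ge 0}$ is a Stieltjes moment sequence.
   Context: The square root denotes the power series with constant term $1$. A sequence $(m_n)_{n\ge0}$ is a Stieltjes moment sequence if $m_n=\int_0^{+\infty}x^n\,d\mu(x)$ for all $n\ge 0$ for some nonnegative measure $\mu$ on $[0,+\infty)$.
   Formalization: At t=0 the displayed fraction is 0/0, so there the generating function is taken to be (1-sx)/((1-px)(1-sx)-qx^2), obtained by cancelling 2t (the limit as t tends to 0); for t>0 the fraction is used as displayed. *)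

(* Defs.v *)
From HB Require Import structures.
From mathcomp Require Import all_boot all_order all_algebra.
From mathcomp Require Import all_classical all_reals all_analysis.
Set Implicit Arguments.
Unset Strict Implicit.
Unset Printing Implicit Defensive.
Import Order.TTheory GRing.Theory Num.Theory.
Import numFieldNormedType.Exports.
Local Open Scope classical_set_scope.
Local Open Scope ring_scope.

(* A formal power series over R is its coefficient sequence nat -> R. *)

Definition fps_of_poly (R : realType) (a : {poly R}) : nat -> R :=
  fun n => a`_n.

Definition fps_add (R : realType) (a b : nat -> R) : nat -> R :=
  fun n => a n + b n.

Definition fps_scale (R : realType) (c : R) (a : nat -> R) : nat -> R :=
  fun n => c * a n.

Definition fps_mul (R : realType) (a b : nat -> R) : nat -> R :=
  fun n => \sum_(i < n.+1) a i * b (n - i)%N.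

Definition is_fps_sqrt (R : realType) (a r : nat -> R) : Prop :=
  r 0%N = 1 /\ fps_mul r r = a.

(* d = a / b; the condition on b makes d the unique solution. *)
Definition is_fps_quot (R : realType) (a b d : nat -> R) : Prop :=
  b 0%N != 0 /\ fps_mul d b = a.

Definition radicand (R : realType) (s t : R) : {poly R} :=
  1 - (2 * s) *: 'X + (s ^+ 2 - 4 * t) *: 'X^2.

(* [r] stands for the square root of [radicand s t].                          *)
(*   At t = 0 one has r = 1 - s X, and numerator and denominator both vanish. *)
(* From (1 - s X - r) (1 - s X + r) = 4 t X^2 the fraction equals, after      *)
(* cancelling 2 t,                                                            *)
(*     1 / (1 - p X - 2 q X^2 / (1 - s X + r)),                               *)
(* whose value at t = 0 is (1 - s X) / ((1 - p X) (1 - s X) - q X^2).         *)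
(* This removes the 0/0, and is the coefficientwise limit as t -> 0.          *)
Definition has_gen_fun (R : realType) (p q s t : R) (r d : nat -> R) : Prop :=
  if t == 0 then
    is_fps_quot
      (fps_of_poly (1 - s *: 'X))
      (fps_of_poly ((1 - p *: 'X) * (1 - s *: 'X) - q *: 'X^2)) d
  else
    is_fps_quot
      (fps_of_poly (2 * t)%:P)
      (fps_add (fps_of_poly ((2 * t - q)%:P + (q * s - 2 * p * t) *: 'X))
               (fps_scale q r)) d.

Definition stieltjes_moment_sequence (R : realType) (m : nat -> R) : Prop :=
  exists mu : {measure set R -> \bar R},
    forall n : nat,
      (\int[mu]_(x in `[0%R, +oo[) (x ^+ n)%:E = (m n)%:E)%E.

(* Main.v *)
(** Write [h] for the power series with [h = x (1 + s h + t h^2)]. The generating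
    function is [d = 1 / (1 - p x - q x h)], hence the coefficients of [d h^k],
    suitably scaled, are the entries of [e_0 J^n], where [J] is the symmetric
    tridiagonal matrix with diagonal [p, s, s, ...] and off-diagonal
    [sqrt q, sqrt t, sqrt t, ...]; in particular [d_n = (J^n)_00].
    With [alpha, beta = (s +- sqrt (s^2 - 4 t)) / 2] one has [s = alpha + beta],
    [t = alpha beta] and [q <= p alpha], which writes the quadratic form of [J]
    as a sum of nonnegative binary forms. The spectral theorem for the truncation
    of [J] to size [N + 1] then yields a discrete probability measure on some
    fixed segment [[0, M]] whose first [N + 1] moments are [d_0, ..., d_N].
    A weak limit of these measures is obtained as the law of a pointwise
    ultrafilter limit of their quantile functions. *)
Require Import Defs.
From HB Require Import structures.
From mathcomp Require Import all_boot all_order all_algebra.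
From mathcomp Require Import all_classical all_reals all_analysis.
From mathcomp Require Import measurable_realfun complex zify ring lra.
Import Order.TTheory GRing.Theory Num.Theory.
Import numFieldNormedType.Exports.
Local Open Scope classical_set_scope.
Local Open Scope ring_scope.

Set Implicit Arguments.
Unset Strict Implicit.
Unset Printing Implicit Defensive.

(** * Formal power series *)

(* An alias, so that the convolution product does not clash with the          *)
(* pointwise ring structure of nat -> R.                                      *)
Definition fps (R : realType) : Type := nat -> R.

HB.instance Definition _ (R : realType) := GRing.Zmodule.copy (fps R) (nat -> R).

Section FpsRing.
Variable R : realType.
Implicit Types a b c : fps R.

Let trunc (n : nat) a : {poly R} := \poly_(i < n.+1) a i.

Let coef_trunc n a i : (i <= n)%N -> (trunc n a)`_i = a i.
Proof. by move=> ?; rewrite coef_poly ltnS ifT. Qed.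

(** Coefficients up to [n] of a convolution see only the truncations of its factors, so
    associativity and commutativity are inherited from polynomials. *)
Let fps_mulE n a b i : (i <= n)%N -> fps_mul a b i = (trunc n a * trunc n b)`_i.
Proof.
move=> ein; rewrite coefM; apply: eq_bigr => j _; rewrite !coef_trunc//.
  by rewrite (leq_trans _ ein)// leq_subr.
by rewrite (leq_trans _ ein)// -ltnS.
Qed.

Let fps_mulA : associative (@fps_mul R).
Proof.
move=> a b c; apply/funext => n.
transitivity (trunc n a * (trunc n b * trunc n c))`_n.
  rewrite coefM; apply: eq_bigr => j _; rewrite coef_trunc -1?ltnS//.
  by rewrite (@fps_mulE n)// leq_subr.
rewrite mulrA coefM; apply: eq_bigr => j _.
by rewrite coef_trunc ?leq_subr// (@fps_mulE n)// -ltnS.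
Qed.

Let fps_mulC : commutative (@fps_mul R).
Proof.
by move=> a b; apply/funext => n; rewrite !(@fps_mulE n)// mulrC.
Qed.

Let fps_mul1 : left_id (fps_of_poly 1) (@fps_mul R).
Proof.
move=> a; apply/funext => n; rewrite /fps_mul big_ord_recl big1.
  by rewrite /fps_of_poly coef1 eqxx mul1r subn0 addr0.
by move=> i _; rewrite /fps_of_poly coef1 mul0r.
Qed.

Let fps_mulDl : left_distributive (@fps_mul R) +%R.
Proof.
move=> a b c; apply/funext => n; rewrite /fps_mul -[RHS]big_split.
by apply: eq_bigr => i _; exact: mulrDl.
Qed.

Let fps1_neq0 : fps_of_poly 1 != 0 :> fps R.
Proof.
apply/eqP => /(congr1 (fun a : fps R => a 0%N)).
by rewrite /fps_of_poly coef1 => /eqP; rewrite oner_eq0.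
Qed.

HB.instance Definition _ := GRing.Zmodule_isComNzRing.Build (fps R)
  fps_mulA fps_mulC fps_mul1 fps_mulDl fps1_neq0.

(** Retyped with values in [fps R], so that it can carry the structure of a ring morphism. *)
Definition fpoly : {poly R} -> fps R := @fps_of_poly R.

Let fpoly_additive : zmod_morphism fpoly.
Proof. by move=> p q; apply/funext => n; rewrite /fpoly /fps_of_poly coefB. Qed.

Let fpoly_multiplicative : monoid_morphism fpoly.
Proof. by split=> // p q; apply/funext => n; rewrite /fpoly /fps_of_poly coefM. Qed.

HB.instance Definition _ := GRing.isZmodMorphism.Build {poly R} (fps R) fpoly
  fpoly_additive.
HB.instance Definition _ := GRing.isMonoidMorphism.Build {poly R} (fps R) fpoly
  fpoly_multiplicative.

Lemma fpolyCM (k : R) a n : (fpoly k%:P * a) n = k * a n.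
Proof.
rewrite -[LHS]/(fps_mul _ _ _) /fps_mul big_ord_recl big1 ?addr0.
  by rewrite /fpoly /fps_of_poly coefC eqxx subn0.
by move=> i _; rewrite /fpoly /fps_of_poly coefC mul0r.
Qed.

Lemma fpolyX_mulS a n : (fpoly 'X * a) n.+1 = a n.
Proof.
rewrite -[LHS]/(fps_mul _ _ _) /fps_mul !big_ord_recl big1.
  by rewrite /fpoly /fps_of_poly !coefX mul0r mul1r add0r addr0 subSS subn0.
by move=> i _; rewrite /fpoly /fps_of_poly coefX mul0r.
Qed.

Lemma fps_mul0 a b : (a * b) 0%N = a 0%N * b 0%N.
Proof. by rewrite -[LHS]/(fps_mul _ _ _) /fps_mul big_ord1. Qed.

Lemma fpolyX_mul0 a : (fpoly 'X * a) 0%N = 0.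
Proof. by rewrite fps_mul0 /fpoly /fps_of_poly coefX mul0r. Qed.

Lemma fpolyX_mulI a b : fpoly 'X * a = fpoly 'X * b -> a = b.
Proof. by move=> ab; apply/funext => n; rewrite -fpolyX_mulS ab fpolyX_mulS. Qed.

Lemma fpolyC_mulI (k : R) a b : k != 0 -> fpoly k%:P * a = fpoly k%:P * b -> a = b.
Proof.
move=> k0 ab; apply/funext => n; apply: (mulfI k0).
by rewrite -!fpolyCM ab.
Qed.

Lemma fpolyZ (k : R) (p : {poly R}) : fpoly (k *: p) = fpoly k%:P * fpoly p.
Proof. by rewrite -mul_polyC rmorphM. Qed.

End FpsRing.

(** * Algebraic equations for the generating function *)

(** The series [h] is [(1 - s X - r) / (2 t X)], degenerating to [X / (1 - s X)] at [t = 0]. The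
    resulting equations have the same form in both cases, so the case distinction on [t] ends
    here. *)
Lemma gen_fun_fixpoint (R : realType) (p q s t : R) (r d : nat -> R) :
  is_fps_sqrt (fps_of_poly (radicand s t)) r -> has_gen_fun p q s t r d ->
  exists h : fps R, [/\ h 0%N = 0,
    h = fpoly 'X * (1 + fpoly s%:P * h + fpoly t%:P * (h * h)) &
    (d : fps R) =
      1 + fpoly 'X * (fpoly p%:P * (d : fps R) + fpoly q%:P * ((d : fps R) * h))].
Proof.
move=> [r0 rr]; pose X : fps R := fpoly 'X; pose D : fps R := d.
rewrite /has_gen_fun; case: eqP => [->|/eqP t0] [_ dE].
(* The geometric series [g] is the inverse of [1 - s X]. *)
- pose g : fps R := fun n => s ^+ n; pose h : fps R := X * g.
  have gE : (1 - fpoly s%:P * X) * g = 1.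
    apply/funext => n; rewrite mulrBl mul1r -mulrA.
    rewrite -[LHS]/(g n - (fpoly s%:P * (X * g)) n) fpolyCM; case: n => [|n].
      by rewrite fpolyX_mul0 mulr0 subr0 /g expr0 -[RHS]/((1%:P : {poly R})`_0) coefC.
    by rewrite fpolyX_mulS /g exprS subrr -[RHS]/((1 : {poly R})`_n.+1) coef1.
  have DE : D * ((1 - fpoly p%:P * X) * (1 - fpoly s%:P * X) - fpoly q%:P * X ^+ 2)
      = 1 - fpoly s%:P * X.
    transitivity (fpoly (1 - s *: 'X)); last by rewrite rmorphB rmorph1 /= fpolyZ.
    rewrite -[RHS]dE -[RHS]/(D * fpoly _); congr (_ * _).
    by rewrite rmorphB rmorphM !rmorphB !rmorph1 /= !fpolyZ rmorphXn.
  exists h; split; first exact: fpolyX_mul0.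
  + rewrite rmorph0 mul0r addr0 -/X {1}/h; congr (X * _).
    by rewrite -gE /h; ring.
  + rewrite -/D -/X.
    have : D * ((1 - fpoly p%:P * X) * (1 - fpoly s%:P * X) - fpoly q%:P * X ^+ 2) * g
        = 1 by rewrite DE gE.
    rewrite (_ : D * _ * g = D * (1 - fpoly p%:P * X) * ((1 - fpoly s%:P * X) * g)
       - fpoly q%:P * X * D * h); last by rewrite /h; ring.
    by rewrite gE mulr1 => <-; ring.
- pose r' : fps R := r.
  have t20 : 2 * t != 0 by rewrite mulf_neq0// pnatr_eq0.
  (* The index shift divides by [X]; this is exact because [r 0 = 1] cancels the constant term. *)
  pose h : fps R := fun n => (1 - fpoly s%:P * X - r') n.+1 / (2 * t).
  have sX0 : (fpoly s%:P * X) 0%N = 0 by rewrite mulrC fpolyX_mul0.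
  have sX1 : (fpoly s%:P * X) 1%N = s.
    by rewrite mulrC fpolyX_mulS /fpoly /fps_of_poly coefC.
  have fps1E n : (1 : fps R) n = (n == 0)%:R.
    by rewrite -[LHS]/((1 : {poly R})`_n) coef1.
  have hE : X * (fpoly (2 * t)%:P * h) = 1 - fpoly s%:P * X - r'.
    apply/funext => -[|n]; rewrite ?fpolyX_mul0 ?fpolyX_mulS.
      rewrite -[RHS]/((1 : fps R) 0%N - (fpoly s%:P * X) 0%N - r 0%N).
      by rewrite sX0 fps1E r0 subr0 subrr.
    by rewrite fpolyCM /h mulrCA mulfV// mulr1.
  (* Comparison of the coefficients of [X] in [r^2]; this is what gives [h 0 = 0]. *)
  have r1 : r 1%N = - s.
    have := congr1 (fun a => a 1%N) rr.
    rewrite /fps_mul big_ord_recr big_ord1/= r0 /fps_of_poly /radicand.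
    rewrite !(coefD, coefN, coefZ, coefX, coefXn, coef1)/= => r1E.
    by lra.
  have rE : r' = 1 - fpoly s%:P * X - X * (fpoly (2 * t)%:P * h).
    by rewrite hE; ring.
  have fpolyn (k : nat) : fpoly (k%:R)%:P = k%:R :> fps R.
    by rewrite polyCMn rmorphMn/= rmorph1.
  have t2E : fpoly (2 * t)%:P = 2 * fpoly t%:P.
    by rewrite polyCM rmorphM /= (fpolyn 2%N).
  exists h; rewrite -/X -/D; split.
  + rewrite /h -[(_ - _ - r') 1%N]/((1 : fps R) 1%N - (fpoly s%:P * X) 1%N - r 1%N).
    by rewrite sX1 fps1E r1 sub0r opprK addNr mul0r.
  + have rr' : r' * r' = 1 - 2 * fpoly s%:P * X
        + (fpoly s%:P ^+ 2 - 4 * fpoly t%:P) * X ^+ 2.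
      rewrite [LHS]rr -[LHS]/(fpoly _) /radicand rmorphD rmorphB rmorph1 /= !fpolyZ.
      rewrite polyCB polyC_exp !polyCM rmorphB !rmorphXn !rmorphM/=.
      by rewrite (fpolyn 2%N) (fpolyn 4%N).
    (* With [r' = 1 - s X - 2 t X h] substituted, the equation for [r'^2] is the fixed-point
       equation for [h] multiplied by [4 t X]. *)
    apply: fpolyX_mulI; apply: (@fpolyC_mulI _ (2 * t)) => //.
    apply: (@fpolyC_mulI _ 2); first by rewrite pnatr_eq0.
    apply/eqP; rewrite -subr_eq0 -/X t2E (fpolyn 2%N).
    move: (esym rr') => /eqP; rewrite -subr_eq0 rE t2E => /eqP <-; apply/eqP; ring.
  (* The same substitution turns the denominator into [2 t (1 - p X - q X h)]. *)
  + apply: (@fpolyC_mulI _ (2 * t)) => //.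
    have : D * (fpoly ((2 * t - q)%:P + (q * s - 2 * p * t) *: 'X) + fpoly q%:P * r')
        = fpoly (2 * t)%:P.
      rewrite -[RHS]dE -[RHS]/(D * (_ : fps R)); congr (_ * _).
      by apply/funext => n; rewrite -[LHS]/(_ n + _ n) fpolyCM.
    rewrite rmorphD /= fpolyZ !polyCB !rmorphB !polyCM !rmorphM/= (fpolyn 2%N) rE t2E.
    move=> /eqP; rewrite -subr_eq0 => /eqP DE.
    apply/eqP; rewrite -subr_eq0 -DE -/X; apply/eqP; ring.
Qed.

(** Column [k] of the array is the series [d h^k]. The equation of [d] gives the recurrence for
    column [0], that of [h] multiplied by [d h^k] the one for column [k + 1], and [h 0 = 0] gives
    the initial row. *)
Lemma gen_fun_array (R : realType) (p q s t : R) (r d : nat -> R) :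
  is_fps_sqrt (fps_of_poly (radicand s t)) r -> has_gen_fun p q s t r d ->
  exists D : nat -> nat -> R, [/\ forall n, D n 0%N = d n,
    forall k, D 0%N k = (k == 0%N)%:R,
    forall n, D n.+1 0%N = p * D n 0%N + q * D n 1%N &
    forall n k, D n.+1 k.+1 = D n k + s * D n k.+1 + t * D n k.+2].
Proof.
move=> rs dg; have [h [h0 hE dE]] := gen_fun_fixpoint rs dg.
pose d' : fps R := d; exists (fun n k => (d' * h ^+ k) n).
have addE (a b : fps R) n : (a + b) n = a n + b n by [].
have d0 : d 0%N = 1.
  have := congr1 (fun a : fps R => a 0%N) dE; rewrite addE fpolyX_mul0 addr0 => ->.
  by rewrite -[LHS]/((1 : {poly R})`_0) coef1.
split=> [n|[|k]|n|n k].
- by rewrite mulr1.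
- by rewrite mulr1.
- by rewrite exprS fps_mul0 fps_mul0 h0 mul0r mulr0.
- rewrite !mulr1 expr1 {1}/d' dE addE fpolyX_mulS addE !fpolyCM.
  by rewrite -[(1 : fps R) _]/((1 : {poly R})`_n.+1) coef1 add0r.
- have dhE : d' * h ^+ k.+1 = fpoly 'X * (d' * h ^+ k
      + fpoly s%:P * (d' * h ^+ k.+1) + fpoly t%:P * (d' * h ^+ k.+2)).
    by rewrite exprS {1}hE !exprS; ring.
  by rewrite [X in X n.+1]dhE fpolyX_mulS !addE !fpolyCM.
Qed.

(** * Jacobi matrices *)

Definition jacobi (R : nzRingType) (b c : nat -> R) (N : nat) : 'M[R]_N.+1 :=
  \matrix_(i, j) (b i *+ (i == j) + c i *+ (i.+1 == j) + c j *+ (j.+1 == i)).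

Lemma jacobi_sym (R : nzRingType) (b c : nat -> R) N :
  (jacobi b c N)^T = jacobi b c N.
Proof.
apply/matrixP => i j; rewrite !mxE eq_sym; case: eqP => [->|_].
  by rewrite addrAC.
by rewrite !mulr0n !add0r addrC.
Qed.

Lemma mul_row_jacobi (R : comNzRingType) (b c y : nat -> R) N (k : 'I_N.+1) :
  ((\row_(i < N.+1) y i) *m jacobi b c N) 0 k =
  b k * y k + (if k : nat is k'.+1 then c k' * y k' else 0)
    + (if (k < N)%N then c k * y k.+1 else 0).
Proof.
have pick (F : nat -> R) m : \sum_(i < N.+1) F i *+ (i == m :> nat)
    = if (m < N.+1)%N then F m else 0.
  rewrite -(@big_ord1_eq _ _ +%R F) [RHS]big_mkcond/=.
  by apply: eq_bigr => i _; case: eqP.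
rewrite mxE.
transitivity (\sum_(i < N.+1) (b i * y i) *+ (i == k :> nat)
    + \sum_(i < N.+1) (c i * y i) *+ (i.+1 == k :> nat)
    + \sum_(i < N.+1) (c k * y i) *+ (i == k.+1 :> nat)).
  rewrite -!big_split/=; apply: eq_bigr => i _; rewrite !mxE.
  by rewrite !mulrDr !mulrnAr (eq_sym k.+1) !(mulrC (y i)).
rewrite !(pick (fun i => b i * y i)) (pick (fun i => c k * y i)) ltn_ord ltnS.
congr (_ + _ + _); case: k => -[|k'] /= kN.
  by rewrite big1.
rewrite (eq_bigr (fun i : 'I_N.+1 => c i * y i *+ (i == k' :> nat)))//.
by rewrite (pick (fun i => c i * y i)) ltnW.
Qed.

Lemma jacobi_form (R : comNzRingType) (b c : nat -> R) N (x : 'rV[R]_N.+1) :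
  let y k := x 0 (inord k) in
  (x *m jacobi b c N *m x^T) 0 0 =
  \sum_(k < N.+1) b k * y k ^+ 2 + 2 * \sum_(k < N) c k * (y k * y k.+1).
Proof.
move=> y; have -> : x = \row_(i < N.+1) y i.
  by apply/rowP => i; rewrite mxE /y inord_val.
rewrite mxE.
under eq_bigr => k _ do rewrite mul_row_jacobi [_^T _ _]mxE mxE.
under eq_bigr => k _ do rewrite !mulrDl.
rewrite !big_split/= -addrA; congr (_ + _).
  by apply: eq_bigr => k _; rewrite expr2 mulrA.
rewrite mulr_natl mulr2n; congr (_ + _).
  rewrite big_ord_recl/= mul0r add0r; apply: eq_bigr => i _.
  by rewrite -mulrA.
rewrite big_ord_recr/= ltnn mul0r addr0; apply: eq_bigr => i _.
by rewrite ltn_ord -mulrA (mulrC (y i.+1)).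
Qed.

(** For [A > 0], multiply by [A] and complete the square; for [A = 0] the hypothesis forces
    [C = 0]. *)
Lemma quadratic_form_ge0 (R : realFieldType) (A B C x y : R) :
  0 <= A -> 0 <= B -> C ^+ 2 <= A * B ->
  0 <= A * x ^+ 2 + 2 * (C * (x * y)) + B * y ^+ 2.
Proof.
move=> A0 B0 CAB; have [A00|An0] := eqVneq A 0.
  move: CAB; rewrite A00 mul0r => C2.
  have /eqP : C ^+ 2 = 0 by apply/le_anti; rewrite C2 sqr_ge0.
  rewrite sqrf_eq0 => /eqP ->.
  by rewrite !mul0r mulr0 !add0r mulr_ge0 ?sqr_ge0.
have Ap : 0 < A by rewrite lt_def An0.
rewrite -(pmulr_rge0 _ Ap).
have -> : A * (A * x ^+ 2 + 2 * (C * (x * y)) + B * y ^+ 2) =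
    (A * x + C * y) ^+ 2 + (A * B - C ^+ 2) * y ^+ 2 by ring.
by rewrite addr_ge0 ?sqr_ge0// mulr_ge0 ?sqr_ge0// subr_ge0.
Qed.

(* Splitting each diagonal entry as [a k + e k], the form becomes a sum of    *)
(* the binary forms on [(y k, y k.+1)] with coefficients [e k], [a k.+1].     *)
Lemma tridiagonal_form_ge0 (R : realFieldType) (a e b c y : nat -> R) N :
  (forall k, a k + e k = b k) -> (forall k, 0 <= a k) -> (forall k, 0 <= e k) ->
  (forall k, c k ^+ 2 <= e k * a k.+1) ->
  0 <= \sum_(k < N.+1) b k * y k ^+ 2 + 2 * \sum_(k < N) c k * (y k * y k.+1).
Proof.
move=> abe a0 e0 ce; pose T n :=
  \sum_(k < n.+1) b k * y k ^+ 2 + 2 * \sum_(k < n) c k * (y k * y k.+1).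
(* Strengthened for the induction: [e n * y n ^+ 2] is the share of the last diagonal term kept for
   the next binary form. *)
suff /(_ N) : forall n, e n * y n ^+ 2 <= T n.
  by apply: le_trans; rewrite mulr_ge0 ?sqr_ge0.
elim=> [|n IH].
  rewrite /T big_ord1 big_ord0 mulr0 addr0 -abe mulrDl lerDr.
  by rewrite mulr_ge0 ?sqr_ge0.
have -> : T n.+1 = T n + b n.+1 * y n.+1 ^+ 2 + 2 * (c n * (y n * y n.+1)).
  by rewrite /T big_ord_recr [X in _ + 2 * X]big_ord_recr/=; ring.
have := quadratic_form_ge0 (y n) (y n.+1) (e0 n) (a0 n.+1) (ce n).
rewrite -abe; move: IH; set u := y n ^+ 2; set v := y n.+1 ^+ 2; set z := y n * _.
move: (T n) => Tn IH H; rewrite -subr_ge0.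
have -> : Tn + (a n.+1 + e n.+1) * v + 2 * (c n * z) - e n.+1 * v =
  (Tn - e n * u) + (e n * u + 2 * (c n * z) + a n.+1 * v) by ring.
by rewrite addr_ge0// subr_ge0.
Qed.

(* The truncation loses only the entry [D n N.+1], which vanishes for n <= N. *)
Lemma jacobi_moments (R : comNzRingType) (b c : nat -> R) (D : nat -> nat -> R)
    (N n : nat) :
  (forall k, D 0%N k = (k == 0%N)%:R) ->
  (forall n k, D n.+1 k = b k * D n k + (if k is k'.+1 then D n k' else 0)
                          + c k ^+ 2 * D n k.+1) ->
  (n <= N)%N -> ((jacobi b c N) ^+ n) 0 0 = D n 0%N.
Proof.
move=> D0 DS nN.
have Dlt m k : (m < k)%N -> D m k = 0.
  elim: m k => [|m IH] [|k]//; rewrite ?D0// => mk.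
  by rewrite DS !IH ?mulr0 ?addr0//; lia.
(* The weights [W k] symmetrise the recurrence: the rows [v m] are [e_0 J^m] for [m <= N]. Nothing
   is divided by [c], so vanishing off-diagonal entries are allowed. *)
pose W k := \prod_(i < k) c i.
have WS k : W k.+1 = W k * c k by rewrite /W big_ord_recr.
pose v m : 'rV[R]_N.+1 := \row_k (W k * D m k).
have vS m : (m <= N)%N -> v m *m jacobi b c N = v m.+1.
  move=> mN; apply/rowP => k; rewrite (mul_row_jacobi _ _ (fun k => W k * D m k)).
  rewrite mxE DS !mulrDr; congr (_ + _ + _); first by rewrite mulrCA.
    by case: k => -[|k] kN /=; rewrite ?mulr0// WS mulrA (mulrC (c k)).
  case: ltnP => kN; first by rewrite WS expr2; ring.
  by rewrite Dlt ?mulr0// ltnS (leq_trans mN).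
have vE m : (m <= N)%N -> v 0%N *m (jacobi b c N) ^+ m = v m.
  elim: m => [|m IH] mN; first by rewrite mulmx1.
  by rewrite exprSr -mulmxE mulmxA IH ?vS// ltnW.
have /rowP/(_ 0) := vE n nN; rewrite [RHS]mxE /W big_ord0 mul1r => <-.
rewrite mxE big_ord_recl big1 ?addr0 => [|i _].
  by rewrite mxE D0 /W big_ord0 !mul1r.
by rewrite mxE D0 mulr0 mul0r.
Qed.

(** * Spectral decomposition of a real symmetric matrix *)

Section SpectralMoments.
Local Open Scope complex_scope.

(** Viewed over the complex numbers, [J] is Hermitian, hence [J = P^-1 diag(lam) P] with [P] unitary
    and [lam] real. The weights are [w i = |P i 0|^2]. *)
Lemma spectral_moments (R : rcfType) (n : nat) (J : 'M[R]_n.+1) (M : R) :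
  J^T = J ->
  (forall x : 'rV_n.+1, 0 <= (x *m J *m x^T) 0 0) ->
  (forall x : 'rV_n.+1, (x *m J *m x^T) 0 0 <= M * (x *m x^T) 0 0) ->
  exists w lam : 'I_n.+1 -> R,
    [/\ forall i, 0 <= w i, forall i, 0 <= lam i <= M &
        forall k, (J ^+ k) 0 0 = \sum_i w i * lam i ^+ k].
Proof.
move=> Jsym J0 JM.
pose A : 'M[R[i]]_n.+1 := map_mx (real_complex R) J.
have Aherm : A \is hermsymmx.
  apply: realsym_hermsym.
    apply/is_hermitianmxP; rewrite expr0 scale1r map_mx_id//.
    by rewrite /A map_trmx Jsym.
  apply/mxOverP => i j; rewrite mxE.
  by apply/complex_realP; exists (J i j).
have Areal := hermitian_spectral_diag_real Aherm.
have /hermitian_normalmx/orthomx_spectralP Aeq := Aherm.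
have Punit := spectral_unit A.
have Pun := spectral_unitarymx A.
move: (spectralmx A) (spectral_diag A) Aeq Areal Punit Pun => P D.
move=> Aeq Dreal Punit Pun.
pose lam i := complex.Re (D 0 i).
have lamE i : D 0 i = (lam i)%:C.
  by have /mxOverP/(_ 0 i)/RRe_real := Dreal.
(* Since [J] and [lam i] are real, the real and imaginary parts of row [i] of [P] both satisfy
   [u J = lam i u]. Either part may vanish, so the bounds on [lam i] come from adding the two forms,
   the squared norms summing to [1]. *)
pose a i : 'rV[R]_n.+1 := \row_j complex.Re (P i j).
pose b i : 'rV[R]_n.+1 := \row_j complex.Im (P i j).
have PAE : P *m A = diag_mx D *m P.
  by rewrite [in LHS]Aeq -mulmxA mulKVmx.
have PA i j : \sum_k P i k * (J k j)%:C = (lam i)%:C * P i j.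
  move/matrixP: PAE => /(_ i j); rewrite mul_diag_mx !mxE lamE => <-.
  by apply: eq_bigr => k _; rewrite !mxE.
have aJ i : a i *m J = lam i *: a i.
  apply/rowP => j; rewrite !mxE.
  have /(congr1 (@complex.Re R)) := PA i j.
  rewrite raddf_sum/= => PAij.
  transitivity (\sum_k complex.Re (P i k * (J k j)%:C)).
    by apply: eq_bigr => k _; rewrite !mxE; case: (P i k) => x y /=; ring.
  by rewrite PAij; case: (P i j) => x y /=; ring.
have bJ i : b i *m J = lam i *: b i.
  apply/rowP => j; rewrite !mxE.
  have /(congr1 (@complex.Im R)) := PA i j.
  rewrite raddf_sum/= => PAij.
  transitivity (\sum_k complex.Im (P i k * (J k j)%:C)).
    by apply: eq_bigr => k _; rewrite !mxE; case: (P i k) => x y /=; ring.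
  by rewrite PAij; case: (P i j) => x y /=; ring.
have ab1 i : (a i *m (a i)^T) 0 0 + (b i *m (b i)^T) 0 0 = 1.
  have /unitarymxP/matrixP/(_ i i) := Pun.
  rewrite !mxE eqxx -big_split/= => /(congr1 (@complex.Re R)).
  rewrite raddf_sum/= => <-; apply: eq_bigr => k _; rewrite !mxE.
  by case: (P i k) => x y /=; ring.
exists (fun i => a i 0 0 ^+ 2 + b i 0 0 ^+ 2), lam; split.
- by move=> i; rewrite addr_ge0 ?sqr_ge0.
- have eigenE (u : 'rV_n.+1) c : u *m J = c *: u ->
      (u *m J *m u^T) 0 0 = c * (u *m u^T) 0 0.
    by move=> ->; rewrite -scalemxAl mxE.
  move=> i; have := J0 (a i); have := J0 (b i); have := JM (a i).
  have := JM (b i); rewrite (eigenE _ _ (aJ i)) (eigenE _ _ (bJ i)).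
  have := ab1 i; set X := (a i *m _) 0 0; set Y := (b i *m _) 0 0.
  move=> XY1 h1 h2 h3 h4; have -> : lam i = lam i * X + lam i * Y.
    by rewrite -mulrDr XY1 mulr1.
  by rewrite addr_ge0//= (le_trans (lerD h2 h1))// -mulrDr XY1 mulr1.
- move=> k.
  have PAk : P *m A ^+ k = diag_mx (map_mx (fun x => x ^+ k) D) *m P.
    elim: k => [|k IH].
      rewrite expr0 mulmx1; apply/matrixP => i j.
      by rewrite mul_diag_mx !mxE expr0 mul1r.
    rewrite exprSr -mulmxE mulmxA IH -mulmxA PAE !mul_diag_mx.
    by apply/matrixP => i j; rewrite !mxE exprSr mulrA.
  have AkE : A ^+ k = invmx P *m (diag_mx (map_mx (fun x => x ^+ k) D) *m P).
    by rewrite -PAk mulKmx.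
  have : (A ^+ k) 0 0 = ((J ^+ k) 0 0)%:C.
    by rewrite /A -rmorphXn/= mxE.
  rewrite AkE => /(congr1 (@complex.Re R)) /= <-.
  rewrite invmx_unitary// mulmxA mxE raddf_sum/=; apply: eq_bigr => i _.
  rewrite mul_mx_diag !mxE lamE -rmorphXn/=.
  by case: (P i 0) => x y /=; ring.
Qed.

End SpectralMoments.

(** * Weak limits through quantile functions *)

Lemma ge0_integral_itv_split (R : realType) (f : R -> R) (a b c : R) :
  measurable_fun setT f -> (forall x, 0 <= f x) -> a <= b -> b <= c ->
  (\int[lebesgue_measure]_(x in `[a, c[) (f x)%:E =
   \int[lebesgue_measure]_(x in `[a, b[) (f x)%:E +
   \int[lebesgue_measure]_(x in `[b, c[) (f x)%:E)%E.
Proof.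
move=> mf f0 ab bc.
rewrite (itv_bndbnd_setU (x := BLeft b)) ?bnd_simp// ge0_integral_setU//=.
- exact/measurable_EFinP/measurable_funTS.
- by move=> x _; rewrite lee_fin.
- apply/disj_setPS => x [] /=; rewrite !in_itv/= => /andP[_ xb] /andP[bx _].
  by move: xb; rewrite ltNge bx.
Qed.

Lemma integral_cst_itv (R : realType) (a b c : R) : a <= b ->
  (\int[lebesgue_measure]_(x in `[a, b[) c%:E = (c * (b - a))%:E)%E.
Proof.
move=> ab; rewrite integral_cst//= lebesgue_measure_itv/= lte_fin.
case: ltP => [_|ba]; first by rewrite EFinM.
by rewrite (le_anti (introT andP (conj ab ba))) mule0 subrr mulr0.
Qed.

Lemma nondecreasing_integral_itv (R : realType) (f : R -> R) (a b : R) :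
  {homo f : x y / x <= y} -> (forall x, 0 <= f x) -> a <= b ->
  ((f a * (b - a))%:E <= \int[lebesgue_measure]_(x in `[a, b[) (f x)%:E
     <= (f b * (b - a))%:E)%E.
Proof.
move=> fnd f0 ab.
have mf : measurable_fun setT f by exact: nondecreasing_measurable.
rewrite -!integral_cst_itv//; apply/andP; split; apply: ge0_le_integral => //=.
all: try by move=> x _; rewrite lee_fin.
all: try by apply/measurable_EFinP/measurable_funTS.
- by move=> x; rewrite in_itv/= => /andP[ax _]; rewrite lee_fin fnd.
- by move=> x; rewrite in_itv/= => /andP[_ xb]; rewrite lee_fin fnd// ltW.
Qed.

Lemma nondecreasing_riemann_sum (R : realType) (f : R -> R) (h : R) (m : nat) :
  {homo f : x y / x <= y} -> (forall x, 0 <= f x) -> 0 <= h ->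
  ((\sum_(j < m) f (j%:R * h) * h)%:E
     <= \int[lebesgue_measure]_(x in `[0%R, (m%:R * h)%R[) (f x)%:E
     <= (\sum_(j < m) f (j.+1%:R * h) * h)%:E)%E.
Proof.
move=> fnd f0 h0.
have mf : measurable_fun setT f by exact: nondecreasing_measurable.
elim: m => [|m /andP[IHl IHu]].
  by rewrite !big_ord0 mul0r set_itvco0 integral_set0 lexx.
rewrite !big_ord_recr/= (ge0_integral_itv_split (b := m%:R * h))//; last 2 first.
- by rewrite mulr_ge0.
- by rewrite ler_wpM2r// ler_nat.
have mh : m%:R * h <= m.+1%:R * h by rewrite ler_wpM2r// ler_nat.
have /andP[] := nondecreasing_integral_itv fnd f0 mh.
rewrite (_ : m.+1%:R * h - m%:R * h = h); last by rewrite -natr1; ring.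
by move=> hl hu; rewrite !EFinD !leeD.
Qed.

(** The right and left Riemann sums differ by a telescoping [(f 1 - f 0) / (k + 1)], so the error
    bound depends on [f] only through [B]. *)
Lemma nondecreasing_integral01 (R : realType) (f : R -> R) (B : R) (k : nat) :
  {homo f : x y / x <= y} -> (forall x, 0 <= f x <= B) ->
  ((\sum_(j < k.+1) f (j%:R / k.+1%:R) / k.+1%:R)%:E
     <= \int[lebesgue_measure]_(x in `[0%R, 1%R[) (f x)%:E
     <= (\sum_(j < k.+1) f (j%:R / k.+1%:R) / k.+1%:R + B / k.+1%:R)%:E)%E.
Proof.
move=> fnd fB.
have f0 x : 0 <= f x by case/andP: (fB x).
have k0 : 0 <= k.+1%:R^-1 :> R by rewrite invr_ge0.
have /andP[] := nondecreasing_riemann_sum k.+1 fnd f0 k0.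
rewrite mulfV// => -> /le_trans ->//; rewrite lee_fin.
rewrite [leLHS]big_ord_recr [X in _ <= X + _]big_ord_recl/= mul0r -addrA addrC.
rewrite -subr_ge0 (_ : _ - _ = f 0 / k.+1%:R + (B - f (k.+1%:R / k.+1%:R)) / k.+1%:R).
  by rewrite addr_ge0// mulr_ge0// subr_ge0; case/andP: (fB (k.+1%:R / k.+1%:R)).
rewrite mulrBl.
ring.
Qed.

(* [l] lists the atoms as (mass, location), [a] is the mass to the left of     *)
(* them, and the value [M] beyond the total mass keeps the function monotone. *)
Fixpoint quantile (R : realType) (M a : R) (l : seq (R * R)) (u : R) : R :=
  if l is (w, x) :: l' then
    if u < a + w then x else quantile M (a + w) l' u
  else M.

(** The lower bound [lo] is left free: [0] gives the range, and the location of an atom gives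
    monotonicity past that atom. *)
Lemma quantile_itv (R : realType) (M lo a : R) l u :
  lo <= M -> all (fun z => lo <= z.2 <= M) l ->
  lo <= quantile M a l u <= M.
Proof.
move=> loM; elim: l a => [|[w x] l IH] a /=; first by rewrite loM lexx.
by move=> /andP[xM al]; case: ifP => // _; exact: IH.
Qed.

Lemma quantile_nondecreasing (R : realType) (M a : R) l :
  sorted (fun y z : R * R => y.2 <= z.2) l -> all (fun z => z.2 <= M) l ->
  {homo quantile M a l : u v / u <= v}.
Proof.
move=> + + u v uv; elim: l a => [|[w x] l IH] a //= pl /andP[xM al].
case: ifPn => [ua|]; case: ifPn => [va|] //.
- have tr : transitive (fun y z : R * R => y.2 <= z.2).
    by move=> ? ? ? /le_trans; apply.
  have xl : all (fun z => x <= z.2 <= M) l.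
    by have := order_path_min tr pl => xl; rewrite all_predI xl al.
  by have /andP[] := quantile_itv (a + w) v xM xl.
- by rewrite (le_lt_trans uv va).
- by move=> _ _; apply: IH => //; exact: path_sorted pl.
Qed.

(** Induction peels off the first atom: on an interval whose length is its mass, the function is
    constantly its location. *)
Lemma quantile_integral (R : realType) (M a : R) l (n : nat) :
  0 <= M -> all (fun z => 0 <= z.2 <= M) l -> all (fun z => 0 <= z.1) l ->
  sorted (fun y z : R * R => y.2 <= z.2) l ->
  (\int[lebesgue_measure]_(u in `[a, (a + \sum_(z <- l) z.1)%R[)
     (quantile M a l u ^+ n)%:E = (\sum_(z <- l) z.1 * z.2 ^+ n)%:E)%E.
Proof.
move=> M0; elim: l a => [|[w x] l IH] a.
  by rewrite !big_nil addr0 set_itvco0 integral_set0.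
move=> alM alw sl.
have sum0 : 0 <= \sum_(z <- l) z.1.
  by rewrite big_seq; apply: sumr_ge0 => z zl; case/andP: alw => _ /allP; apply.
have w0 : 0 <= w by case/andP: alw.
rewrite !big_cons/= (ge0_integral_itv_split (b := a + w)) ?lerDl//; last 3 first.
- apply: (@measurable_funX _ _ _ _ (quantile M a ((w, x) :: l))).
  apply: nondecreasing_measurable => //; apply: quantile_nondecreasing => //.
  by apply: sub_all alM => z /andP[].
- move=> u; apply: exprn_ge0.
  by have /andP[] := quantile_itv a u M0 alM.
- by rewrite addrA lerDl.
rewrite EFinD; congr (_ + _)%E.
  rewrite (eq_integral (cst (x ^+ n)%:E)).
    by rewrite /cst integral_cst_itv ?lerDl// addrAC subrr add0r mulrC.
  by move=> u; rewrite inE/= in_itv/= => /andP[_ ->].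
rewrite addrA -(IH (a + w))//.
- apply: eq_integral => u; rewrite inE/= in_itv/= => /andP[+ _].
  by rewrite leNgt => /negbTE ->.
- by case/andP: alM.
- by case/andP: alw.
- exact: path_sorted sl.
Qed.

(** Sorting the atoms by location makes the quantile function monotone and leaves the moment sums
    unchanged. *)
Lemma discrete_quantile (R : realType) (N : nat) (w lam : 'I_N -> R) (M : R) :
  0 <= M -> (forall i, 0 <= w i) -> (forall i, 0 <= lam i <= M) ->
  \sum_i w i = 1 ->
  exists Q : R -> R, [/\ {homo Q : u v / u <= v}, forall u, 0 <= Q u <= M &
    forall n, (\int[lebesgue_measure]_(u in `[0%R, 1%R[) (Q u ^+ n)%:E =
               (\sum_i w i * lam i ^+ n)%:E)%E].
Proof.
move=> M0 w0 lamM w1.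
pose le2 := fun y z : R * R => y.2 <= z.2.
pose l0 := [seq (w i, lam i) | i <- index_enum 'I_N].
pose l := sort le2 l0.
have lM : all (fun z => 0 <= z.2 <= M) l.
  by rewrite all_sort; apply/allP => z /mapP[i _ ->] /=.
have lw : all (fun z => 0 <= z.1) l.
  by rewrite all_sort; apply/allP => z /mapP[i _ ->] /=.
have ls : sorted le2 l by apply: sort_sorted => y z; exact: le_total.
have lE (F : R * R -> R) : \sum_(z <- l) F z = \sum_i F (w i, lam i).
  by rewrite (perm_big l0) ?big_map// /l perm_sort.
exists (quantile M 0 l); split.
- by apply: quantile_nondecreasing => //; apply: sub_all lM => z /andP[].
- by move=> u; exact: quantile_itv.
- move=> n; rewrite -(lE (fun z => z.1 * z.2 ^+ n)).
  by rewrite -(quantile_integral 0 n M0 lM lw ls) lE w1 add0r.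
Qed.

(** The image of [U] under [u] is again an ultrafilter; it contains the compact segment, hence
    converges in it. *)
Lemma ultrafilter_cvg_segment (R : realType) (U : set_system nat) (a b : R)
    (u : nat -> R) :
  UltraFilter U -> (forall n, a <= u n <= b) ->
  exists2 l, a <= l <= b & u x @[x --> U] --> l.
Proof.
move=> UU uab.
have UV : UltraFilter (u x @[x --> U]).
  split; first exact: fmap_proper_filter.
  move=> G GF UG; rewrite predeqE => A; split => [GA|]; last exact: UG.
  have [//|UnA] := in_ultra_setVsetC (u @^-1` A) UU.
  have /filter_ex[x []//] : G (A `&` ~` A) by apply: filterI => //; exact: UG.
have := @segment_compact R a b; rewrite compact_ultra => /(_ _ UV).
case.
  suff: U (u @^-1` `[a, b]) by [].
  by apply: filterE => n; rewrite /= in_itv/=; exact: uab.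
by move=> l [/=]; rewrite in_itv/= => lab ul; exists l.
Qed.

(* Monotonicity makes the Riemann-sum error uniform in N, which is what lets  *)
(* the integrals pass to a limit along a mere ultrafilter, where dominated    *)
(* convergence is unavailable.                                                *)
Lemma quantile_moments_limit (R : realType) (M : R) (Q_ : nat -> R -> R)
    (m : nat -> R) :
  (forall N, {homo Q_ N : u v / u <= v}) ->
  (forall N u, 0 <= Q_ N u <= M) ->
  (forall N n, (n <= N)%N ->
    (\int[lebesgue_measure]_(u in `[0%R, 1%R[) (Q_ N u ^+ n)%:E = (m n)%:E)%E) ->
  exists Q : R -> R, [/\ {homo Q : u v / u <= v}, forall u, 0 <= Q u <= M &
    forall n, (\int[lebesgue_measure]_(u in `[0%R, 1%R[) (Q u ^+ n)%:E =
               (m n)%:E)%E].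
Proof.
move=> Qnd QM Qm.
(* Since [U] refines the filter of cofinal segments, a property valid for all [N >= n] holds along
   [U]; a single [U] serves every point [u]. *)
have [U [UU ooU]] := ultraFilterLemma (eventually_filter).
have UP : ProperFilter U by exact: ultra_proper.
have /choice[Q QP] : forall u, exists l, 0 <= l <= M /\ Q_ N u @[N --> U] --> l.
  by move=> u; have [l ? ?] := ultrafilter_cvg_segment UU (QM^~ u); exists l.
have Qnd' : {homo Q : u v / u <= v}.
  move=> u v uv; apply: (ler_cvg_to (QP u).2 (QP v).2).
  by apply: filterE => N; exact: Qnd.
have QM' u : 0 <= Q u <= M by exact: (QP u).1.
exists Q; split=> // n.
have Xnd (f : R -> R) : {homo f : u v / u <= v} -> (forall u, 0 <= f u <= M) ->
    {homo (fun u => f u ^+ n) : u v / u <= v}.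
  move=> fnd fM u v uv.
  have /andP[fu0 _] := fM u; have /andP[fv0 _] := fM v.
  by apply: lerXn2r; rewrite ?nnegrE ?fnd.
have XM (f : R -> R) : (forall u, 0 <= f u <= M) ->
    forall u, 0 <= f u ^+ n <= M ^+ n.
  move=> fM u; have /andP[f0 fm] := fM u.
  by rewrite exprn_ge0//= lerXn2r ?nnegrE// (le_trans f0).
pose S (f : R -> R) k := \sum_(j < k.+1) f (j%:R / k.+1%:R) ^+ n / k.+1%:R.
have SQ k : S (Q_ N) k @[N --> U] --> S Q k.
  apply: cvg_big => [|j _]; first exact: add_continuous.
  apply: (cvgM _ (cvg_cst _)); pose x := j%:R / k.+1%:R : R.
  exact: cvg_comp (QP x).2 (@exprn_continuous R n (Q x)).
(* For fixed [k] the sum is finite, so pointwise limits suffice to carry the Riemann bounds from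
   [Q_ N] to [Q]. *)
have Sm k : S Q k <= m n <= S Q k + M ^+ n / k.+1%:R.
  have near_m : U [set N | S (Q_ N) k <= m n <= S (Q_ N) k + M ^+ n / k.+1%:R].
    apply: ooU; exists n => // N /= nN.
    have := nondecreasing_integral01 k (Xnd _ (Qnd N) (QM N)) (XM _ (QM N)).
    by rewrite Qm// !lee_fin.
  apply/andP; split.
    apply: (ler_cvg_to (SQ k) (cvg_cst (m n))).
    by apply: filterS near_m => N /andP[].
  apply: (ler_cvg_to (cvg_cst (m n)) (cvgD (SQ k) (cvg_cst _))).
  by apply: filterS near_m => N /andP[].
(* The one-point Riemann bounds show that the integral is finite. *)
have := nondecreasing_integral01 0 (Xnd _ Qnd' QM') (XM _ QM').
set I := (\int[_]_(u in _) _)%E => I01.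
have [r Ir] : exists r, I = r%:E.
  case: I I01 => [r _|/andP[_]|/andP[]]; first by exists r.
    by rewrite leye_eq.
  by rewrite leeNy_eq.
have Sr k : S Q k <= r <= S Q k + M ^+ n / k.+1%:R.
  have := nondecreasing_integral01 k (Xnd _ Qnd' QM') (XM _ QM').
  by rewrite -/I Ir !lee_fin.
(* Both [r] and [m n] lie in an interval of length [M ^+ n / k.+1%:R], for every [k]. *)
rewrite Ir; congr (_%:E); apply/eqP; rewrite -subr_eq0 -normr_le0.
have cv : M ^+ n * (k.+1%:R^-1 : R) @[k --> \oo] --> M ^+ n * 0.
  by apply: (cvgM (cvg_cst _)); exact: cvg_harmonic.
rewrite mulr0 in cv.
apply: (ler_cvg_to (cvg_cst _) cv); apply: filterE => k.
move: (Sm k) (Sr k) => /=; move: (S Q k) (M ^+ n / k.+1%:R) => s e.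
by move=> /andP[? ?] /andP[? ?]; rewrite ler_norml; apply/andP; split; lra.
Qed.

(** The measure is the law of [Q] under the uniform probability on the unit interval; as [Q >= 0],
    restricting to the half-line loses nothing. *)
Lemma stieltjes_of_quantile (R : realType) (M : R) (Q : R -> R) (m : nat -> R) :
  {homo Q : u v / u <= v} -> (forall u, 0 <= Q u <= M) ->
  (forall n, (\int[lebesgue_measure]_(u in `[0%R, 1%R[) (Q u ^+ n)%:E =
              (m n)%:E)%E) ->
  stieltjes_moment_sequence m.
Proof.
move=> Qnd QM Qm.
have mQ : measurable_fun (T := measurableTypeR R) (U := R) setT Q.
  exact: nondecreasing_measurable.
pose P : {measure set (measurableTypeR R) -> \bar R} := uniform_prob (@ltr01 R).
pose mu := measure_function_pushforward__canonical__measure_function_Measure P mQ.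
exists mu => n.
transitivity (\int[P]_(x in Q @^-1` `[0%R, +oo[) (Q x ^+ n)%:E)%E.
  apply: (ge0_integral_pushforward mQ P) => //.
    by apply/measurable_EFinP; exact: exprn_measurable.
  by move=> x; rewrite inE/= in_itv/= andbT => x0; rewrite lee_fin exprn_ge0.
rewrite (_ : _ @^-1` _ = setT) ?integral_uniform/=.
- rewrite subr0 invr1 mul1e -Qm integral_itv_bndo_bndc//.
  exact/measurable_EFinP/measurable_funTS/measurable_funX.
- exact/measurable_EFinP/measurable_funX.
- by move=> x; rewrite lee_fin exprn_ge0//; case/andP: (QM x).
- by apply/seteqP; split=> // x _ /=; rewrite in_itv/= andbT; case/andP: (QM x).
Qed.

(** * Bounds on the Jacobi form and conclusion *)

(** Both [J] and [M I - J] are tridiagonal, and each is shown nonnegative by splitting its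
    diagonal. *)
Lemma jacobi_form_bounds (R : rcfType) (p q s t : R) (N : nat) (x : 'rV[R]_N.+1) :
  0 <= p -> 0 <= q -> 0 <= s -> 0 <= t -> 4 * t <= s ^+ 2 ->
  q <= p * (s + Num.sqrt (s ^+ 2 - 4 * t)) / 2 ->
  0 <= (x *m jacobi (fun k => if k is 0%N then p else s)
               (fun k => if k is 0%N then Num.sqrt q else Num.sqrt t) N *m x^T) 0 0
    <= (p + s + 2 * Num.sqrt q + 2 * Num.sqrt t) * (x *m x^T) 0 0.
Proof.
move=> p0 q0 s0 t0 st pq.
pose b k := if k is 0%N then p else s.
pose c k := if k is 0%N then Num.sqrt q else Num.sqrt t.
pose y k := x 0 (inord k).
have formE : (x *m jacobi b c N *m x^T) 0 0 =
  \sum_(k < N.+1) b k * y k ^+ 2 + 2 * \sum_(k < N) c k * (y k * y k.+1).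
  exact: jacobi_form.
rewrite -/b -/c formE.
have xxE : (x *m x^T) 0 0 = \sum_(k < N.+1) y k ^+ 2.
  by rewrite mxE; apply: eq_bigr => k _; rewrite mxE /y inord_val expr2.
have sq0 : 0 <= Num.sqrt q := sqrtr_ge0 _.
have st0 : 0 <= Num.sqrt t := sqrtr_ge0 _.
have sqE : Num.sqrt q ^+ 2 = q by rewrite sqr_sqrtr.
have stE : Num.sqrt t ^+ 2 = t by rewrite sqr_sqrtr.
apply/andP; split.
- have d0 : 0 <= s ^+ 2 - 4 * t by rewrite subr_ge0.
  set d := Num.sqrt (s ^+ 2 - 4 * t) in pq.
  have dE : d ^+ 2 = s ^+ 2 - 4 * t by rewrite sqr_sqrtr.
  have dge0 : 0 <= d := sqrtr_ge0 _.
  have ds : d <= s.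
    by rewrite -(@ler_pXn2r _ 2)// dE lerBlDr lerDl mulr_ge0.
  (* The splitting is [p = 0 + p] and [s = alpha + beta]. The first binary form needs
     [q <= p alpha], the hypothesis; the others need [t <= beta alpha], an equality. *)
  apply: (@tridiagonal_form_ge0 _ (fun k => if k is 0%N then 0 else (s + d) / 2)
     (fun k => if k is 0%N then p else (s - d) / 2)).
  + by case=> [|k]; rewrite /b ?add0r//; field.
  + by case=> // k; rewrite divr_ge0// addr_ge0.
  + by case=> // k; rewrite divr_ge0// subr_ge0.
  + case=> [|k]; rewrite /c ?sqE ?stE; first by rewrite mulrA.
    rewrite (_ : (s - d) / 2 * ((s + d) / 2) = (s ^+ 2 - d ^+ 2) / 4); last by field.
    by rewrite dE; lra.
- set M := p + s + _ + _; rewrite -subr_ge0 xxE.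
  have -> : M * \sum_(k < N.+1) y k ^+ 2 -
     (\sum_(k < N.+1) b k * y k ^+ 2 + 2 * \sum_(k < N) c k * (y k * y k.+1)) =
     \sum_(k < N.+1) (M - b k) * y k ^+ 2 +
       2 * \sum_(k < N) (- c k) * (y k * y k.+1).
    have -> : \sum_(k < N.+1) (M - b k) * y k ^+ 2 =
        M * \sum_(k < N.+1) y k ^+ 2 - \sum_(k < N.+1) b k * y k ^+ 2.
      by rewrite mulr_sumr -sumrB; apply: eq_bigr => k _; rewrite mulrBl.
    have -> : \sum_(k < N) - c k * (y k * y k.+1) =
        - \sum_(k < N) c k * (y k * y k.+1).
      by rewrite -sumrN; apply: eq_bigr => k _; rewrite mulNr.
    by ring.
  (* [M] is chosen so that [M - p] and [(M - s) / 2] are both at least [sqrt q] and [sqrt t]. *)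
  apply: (@tridiagonal_form_ge0 _ (fun k => if k is 0%N then 0 else (M - s) / 2)
     (fun k => if k is 0%N then M - p else (M - s) / 2)
     (fun k => M - b k) (fun k => - c k) y N).
  + by case=> [|k]; rewrite /b ?add0r//; field.
  + by case=> // k; rewrite /M; lra.
  + by case=> [|k]; rewrite /M; lra.
  + case=> [|k]; rewrite /c sqrrN.
      by rewrite expr2 ler_pM// /M; lra.
    by rewrite expr2 ler_pM// /M; lra.
Qed.

Unset Implicit Arguments.

Theorem theorem2p7 (R : realType) (p q s t : R) (r d : nat -> R)
  (p_ge0 : 0 <= p) (q_ge0 : 0 <= q) (s_ge0 : 0 <= s) (t_ge0 : 0 <= t)
  (r_sqrt : is_fps_sqrt (fps_of_poly (radicand s t)) r)
  (d_gen_fun : has_gen_fun p q s t r d)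
  (s2_ge_4t : 4 * t <= s ^+ 2)
  (p_q : q <= p * (s + Num.sqrt (s ^+ 2 - 4 * t)) / 2) :
  stieltjes_moment_sequence d.
Proof.
have [D [Dd D0 DS0 DS]] := gen_fun_array r_sqrt d_gen_fun.
pose b k := if k is 0%N then p else s.
pose c k := if k is 0%N then Num.sqrt q else Num.sqrt t.
(* This bound is independent of [N], so all the quantile functions below take values in one
   segment. *)
pose M := p + s + 2 * Num.sqrt q + 2 * Num.sqrt t.
have M0 : 0 <= M by rewrite !addr_ge0 ?mulr_ge0 ?sqrtr_ge0.
have Jd N n : (n <= N)%N -> (jacobi b c N ^+ n) 0 0 = d n.
  rewrite -Dd; apply: jacobi_moments => // m [|k]; rewrite /b /c sqr_sqrtr//.
    by rewrite DS0 addr0.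
  by rewrite DS; ring.
have Jb N (x : 'rV_N.+1) := jacobi_form_bounds x p_ge0 q_ge0 s_ge0 t_ge0 s2_ge_4t p_q.
have /choice[Q QP] : forall N, exists Q : R -> R,
    [/\ {homo Q : u v / u <= v}, forall u, 0 <= Q u <= M & forall n, (n <= N)%N ->
      (\int[lebesgue_measure]_(u in `[0%R, 1%R[) (Q u ^+ n)%:E = (d n)%:E)%E].
  move=> N; have [||w [lam [w0 lamM wlam]]] :=
      @spectral_moments R N (jacobi b c N) M (jacobi_sym _ _ _).
  - by move=> x; case/andP: (Jb N x).
  - by move=> x; case/andP: (Jb N x).
  (* The moment of order [0] is the corner entry of the identity matrix, so the weights form a
     probability. *)
  have w1 : \sum_i w i = 1.
    have := wlam 0%N; rewrite expr0 mxE => /esym; rewrite /= mulr1n => <-.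
    by apply: eq_bigr => i _; rewrite mulr1.
  have [Q [Qnd QM Qm]] := discrete_quantile M0 w0 lamM w1.
  by exists Q; split=> // n nN; rewrite Qm -wlam Jd.
have [|||Q' [Qnd QM Qm]] := @quantile_moments_limit R M Q d.
- by move=> N; case: (QP N).
- by move=> N; case: (QP N).
- by move=> N n; case: (QP N) => _ _; apply.
exact: stieltjes_of_quantile Qnd QM Qm.
Qed.
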